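(* Let $V$ be an $m\times n$ $(0,1)$-matrix and $B$ a $p\times q$ $(0,1)$-matrix, let $L=\begin{bmatrix}0 & V\\ V^T & 0\end{bmatrix}$, $H=\begin{bmatrix}0 & B\\ B^T & 0\end{bmatrix}$, $H^{\#}=\begin{bmatrix}0 & B^T\\ B & 0\end{bmatrix}$, and suppose the bipartite graphs $G_L$ and $G_H$ have no isolated vertices. Suppose $G_L$ is a biregular bipartite graph with distinct degrees and $G_H$ is balanced (i.e. $p=q$). Then $G_{L\underline{\otimes}H}$ and $G_{L\underline{\otimes}H^{\#}}$ are nonisomorphic if and only if $G_H$ does not admit an automorphism that interchanges its partite sets (the partite sets being those indexed by the rows and by the columns of $B$).
   Context: For a symmetric $(0,1)$-matrix $A$ with zero diagonal, $G_A$ is the simple graph with adjacency matrix $A$; so $G_L$ (resp. $G_H$) is the bipartite graph with biadjacency matrix $V$ (resp. $B$), whose partite sets are indexed by the rows and by the columns of $V$ (resp. $B$). A bipartite graph is biregular with distinct degrees if every vertex in one partite set has degree $k$, every vertex in the other partite set has degree $l$, and $k\neq l$. $G_H$ is balanced if its two partite sets have equal size, $p=q$. The partitioned tensor product of $2\times 2$ block matrices is $\begin{bmatrix}U & V'\\ W & X\end{bmatrix}\underline{\otimes}\begin{bmatrix}A & B'\\ C & D\end{bmatrix}=\begin{bmatrix}U\otimes A & V'\otimes B'\\ W\otimes C & X\otimes D\end{bmatrix}$ ($\otimes$ the Kronecker product), so $L\underline{\otimes}H=\begin{bmatrix}0 & V\otimes B\\ V^T\otimes B^T & 0\end{bmatrix}$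 and $L\underline{\otimes}H^{\#}=\begin{bmatrix}0 & V\otimes B^T\\ V^T\otimes B & 0\end{bmatrix}$. An automorphism $f$ of a bipartite graph with partite sets $X,Y$ interchanges the partite sets if $f(X)=Y$ and $f(Y)=X$. *)

(* Defs.v *)
From mathcomp Require Import all_boot all_order all_algebra.
From mathcomp.real_closed Require Import mxtens.

Set Implicit Arguments.
Unset Strict Implicit.
Unset Printing Implicit Defensive.

Import GRing.Theory.
Local Open Scope ring_scope.

Definition is_01mx (a b : nat) (A : 'M[int]_(a, b)) : Prop :=
  forall i j, A i j = 0 \/ A i j = 1.

(* A graph is given by its adjacency relation on a finType.  mxgraph A is the
   simple graph G_A when A is a symmetric (0,1)-matrix with zero diagonal. *)
Definition mxgraph (a : nat) (A : 'M[int]_a) : rel 'I_a :=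
  fun i j => A i j == 1.

Definition degree (T : finType) (e : rel T) (x : T) : nat :=
  #|[set y | e x y]|.

Definition no_isolated_vertex (T : finType) (e : rel T) : Prop :=
  forall x, exists y, e x y.

Definition is_graph_iso (T1 T2 : finType) (e1 : rel T1) (e2 : rel T2)
    (f : T1 -> T2) : Prop :=
  bijective f /\ forall x y, e2 (f x) (f y) = e1 x y.

Definition graph_isomorphic (T1 T2 : finType) (e1 : rel T1) (e2 : rel T2) :
    Prop :=
  exists f : T1 -> T2, is_graph_iso e1 e2 f.

Definition biregular_distinct (T : finType) (e : rel T) (X Y : {set T}) :
    Prop :=
  exists k l : nat,
    [/\ forall x, x \in X -> degree e x = k,
        forall y, y \in Y -> degree e y = l
      & k <> l].

Definition interchanging_automorphism (T : finType) (e : rel T)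
    (X Y : {set T}) (f : T -> T) : Prop :=
  [/\ is_graph_iso e e f, f @: X = Y & f @: Y = X].

Definition bip_mx (a b : nat) (B : 'M[int]_(a, b)) : 'M[int]_(a + b) :=
  block_mx 0 B B^T 0.

(* H^# when H = bip_mx B *)
Definition bip_mx_sharp (a b : nat) (B : 'M[int]_(a, b)) : 'M[int]_(b + a) :=
  block_mx 0 B^T B 0.

Definition row_part (a b : nat) : {set 'I_(a + b)} :=
  [set lshift b i | i : 'I_a].

Definition col_part (a b : nat) : {set 'I_(a + b)} :=
  [set rshift a j | j : 'I_b].

Definition part_tensmx (a1 a2 b1 b2 c1 c2 d1 d2 : nat)
    (M : 'M[int]_(a1 + a2, b1 + b2)) (N : 'M[int]_(c1 + c2, d1 + d2)) :
    'M[int]_(a1 * c1 + a2 * c2, b1 * d1 + b2 * d2) :=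
  block_mx (ulsubmx M *t ulsubmx N) (ursubmx M *t ursubmx N)
           (dlsubmx M *t dlsubmx N) (drsubmx M *t drsubmx N).

Lemma part_tensmx_block (a1 a2 b1 b2 c1 c2 d1 d2 : nat)
    (U : 'M[int]_(a1, b1)) (V : 'M[int]_(a1, b2))
    (W : 'M[int]_(a2, b1)) (X : 'M[int]_(a2, b2))
    (A : 'M[int]_(c1, d1)) (B : 'M[int]_(c1, d2))
    (C : 'M[int]_(c2, d1)) (D : 'M[int]_(c2, d2)) :
  part_tensmx (block_mx U V W X) (block_mx A B C D) =
  block_mx (U *t A) (V *t B) (W *t C) (X *t D).
Proof.
by rewrite /part_tensmx !block_mxKul !block_mxKur !block_mxKdl !block_mxKdr.
Qed.

Lemma part_tensmx_bip (m n p q : nat)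
    (V : 'M[int]_(m, n)) (B : 'M[int]_(p, q)) :
  part_tensmx (bip_mx V) (bip_mx B) = bip_mx (V *t B).
Proof. by rewrite part_tensmx_block /bip_mx trmx_tens !tens0mx. Qed.

Lemma part_tensmx_bip_sharp (m n p q : nat)
    (V : 'M[int]_(m, n)) (B : 'M[int]_(p, q)) :
  part_tensmx (bip_mx V) (bip_mx_sharp B) = bip_mx (V *t B^T).
Proof. by rewrite part_tensmx_block /bip_mx trmx_tens trmxK !tens0mx. Qed.

Lemma bip_mxgraph_sym (a b : nat) (B : 'M[int]_(a, b)) :
  symmetric (mxgraph (bip_mx B)).
Proof.
move=> x y; rewrite /mxgraph.
have -> : bip_mx B = (bip_mx B)^T by rewrite /bip_mx tr_block_mx trmxK !trmx0.
by rewrite mxE; congr (_ == _); rewrite [in RHS]/bip_mx tr_block_mx trmxK !trmx0.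
Qed.

Lemma bip_mxgraph_irr (a b : nat) (B : 'M[int]_(a, b)) :
  irreflexive (mxgraph (bip_mx B)).
Proof.
move=> x; rewrite /mxgraph /bip_mx; case: (split_ordP x) => i ->.
  by rewrite block_mxEul mxE.
by rewrite block_mxEdr mxE.
Qed.

(* Main.v *)
Require Import Defs.
From mathcomp Require Import all_boot all_order all_algebra.
From mathcomp Require Import zify.
From mathcomp.real_closed Require Import mxtens.

(** Lovász-style homomorphism counting.  The direct product of [G_L] and [G_H]
    splits into the part on pairs of vertices of equal colour, which is the graph
    of the tensor product with [H], and the part on pairs of different colours,
    which is the graph of the tensor product with [H^#].  For a connected
    2-coloured pattern [T] let [a, a'] be the numbers of homomorphisms [T -> G_L]
    that respect, resp. reverse, the colours, and [b_j, b'_j] the analogous numbers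
    for [T -> G_H] that send a fixed vertex [v] to a vertex of degree [j].  An
    isomorphism of the two parts preserves the number of homomorphisms sending
    [v] to a vertex of degree [D]; since the degrees [k, l] in [G_L] are constant
    on each side, this says [a (b_(D/k) - b'_(D/k)) = a' (b_(D/l) - b'_(D/l))], and
    [k <> l] forces [b = b'].  Products extend this to disconnected patterns, and
    inclusion-exclusion on coincidences to injective homomorphisms; as the
    identity of [G_H] is colour-respecting, there is an injective
    colour-reversing endomorphism of [G_H], which is an automorphism. *)

Set Implicit Arguments.
Unset Strict Implicit.
Unset Printing Implicit Defensive.

(** * Homomorphisms of 2-coloured patterns with identifications *)

Section Homs.
Variables (T U : finType) (g : rel U) (d : U -> bool).
Implicit Types (e q : rel T) (c : T -> bool) (f : {ffun T -> U}).

(** The relation [q] lists pairs of vertices to be identified, so these are the homomorphisms from a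
    quotient of the pattern, without forming the quotient type. *)
Definition homs e q : {set {ffun T -> U}} :=
  [set f : {ffun T -> U} | [forall x, forall y,
     (e x y ==> g (f x) (f y)) && (q x y ==> (f x == f y))]].

Definition coloured c : {set {ffun T -> U}} :=
  [set f : {ffun T -> U} | [forall x, d (f x) == c x]].

Lemma homsP e q f :
  reflect ((forall x y, e x y -> g (f x) (f y)) /\
           (forall x y, q x y -> f x = f y)) (f \in homs e q).
Proof.
rewrite inE; apply: (iffP 'forall_forallP) => [H | [He Hq] x y].
  split=> x y xy; have /andP[/implyP h1 /implyP h2] := H x y; first exact: h1.
  exact/eqP/h2.
by apply/andP; split; apply/implyP; [apply: He | move/Hq ->].
Qed.

Lemma colouredP c f : reflect (forall x, d (f x) = c x) (f \in coloured c).
Proof.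
rewrite inE; apply: (iffP forallP) => H x; first exact/eqP.
by rewrite H.
Qed.

Definition bipartite := forall u w, g u w -> d u = ~~ d w.

Definition compatible e q c :=
  (forall x y, e x y -> c x = ~~ c y) /\ (forall x y, q x y -> c x = c y).

Lemma homs_compatible e q c f :
  bipartite -> f \in homs e q -> f \in coloured c -> compatible e q c.
Proof.
move=> gB /homsP[fe fq] /colouredP fc.
by split=> x y xy; rewrite -!fc; [apply/gB/fe | rewrite (fq _ _ xy)].
Qed.

(** Closed sets are the unions of components of the pattern, with [q]-pairs counted as edges. *)
Definition closed_under e q (S : {set T}) :=
  forall x y, e x y || q x y -> (x \in S) = (y \in S).

Definition connected_from e q v :=
  forall S : {set T}, closed_under e q S -> v \in S -> S = setT.

(** The vertices where the colour of [f] deviates from [c] exactly as it does at [v] form a closed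
    set, hence all of [T]. *)
Lemma connected_homs_coloured e q c v f :
    bipartite -> compatible e q c -> connected_from e q v ->
  f \in homs e q -> f \in coloured (fun x => c x (+) (c v (+) d (f v))).
Proof.
move=> gB [ce cq] conn /homsP[fe fq]; apply/colouredP => x.
pose S := [set y | d (f y) == c y (+) (c v (+) d (f v))].
suff /eqP: x \in S by rewrite inE => /eqP/eqP.
rewrite (conn S) ?inE //; last by rewrite addbA addbb.
move=> y z; rewrite !inE => /orP[yz|yz]; last by rewrite (fq _ _ yz) (cq _ _ yz).
by rewrite (gB _ _ (fe _ _ yz)) (ce _ _ yz) addNb (inj_eq negb_inj).
Qed.

End Homs.

(** * Multiplicativity over components *)

Section Restriction.
Variables (T U : finType) (g : rel U) (d : U -> bool).
Variables (e q : rel T) (c : T -> bool) (S : {set T}).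

Definition sub_homs (A : {set T}) : {set {ffun {x | x \in A} -> U}} :=
  homs g (fun x y => e (val x) (val y)) (fun x y => q (val x) (val y))
  :&: coloured d (fun x => c (val x)).

(** No constraint links [S] to its complement, so the restrictions to the two pieces can be chosen
    independently. *)
Lemma card_homs_split : closed_under e q S ->
  #|homs g e q :&: coloured d c| = (#|sub_homs S| * #|sub_homs (~: S)|)%N.
Proof.
move=> clS; rewrite -cardsX.
pose F (f : {ffun T -> U}) :=
  ([ffun x : {x | x \in S} => f (val x)],
   [ffun x : {x | x \in ~: S} => f (val x)]).
have Finj : injective F.
  move=> f1 f2 [/ffunP E1 /ffunP E2]; apply/ffunP => x.
  have [xS|xS] := boolP (x \in S); first by have := E1 (Sub x xS); rewrite !ffunE.
  have xS' : x \in ~: S by rewrite inE.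
  by have := E2 (Sub x xS'); rewrite !ffunE.
rewrite -(card_imset _ Finj); apply: eq_card => -[f1 f2].
rewrite in_setX /=; apply/imsetP/andP => [[f] | []].
  rewrite inE => /andP[/homsP[fe fq] /colouredP fc] [-> ->].
  split; rewrite inE; apply/andP; split; [apply/homsP; split | apply/colouredP |
    apply/homsP; split | apply/colouredP].
  - by move=> x y /fe; rewrite !ffunE.
  - by move=> x y /fq; rewrite !ffunE.
  - by move=> x; rewrite !ffunE.
  - by move=> x y /fe; rewrite !ffunE.
  - by move=> x y /fq; rewrite !ffunE.
  - by move=> x; rewrite !ffunE.
rewrite !in_setI => /andP[/homsP[fe1 fq1] /colouredP fc1].
move=> /andP[/homsP[fe2 fq2] /colouredP fc2].
have notS x : (x \in S) = false -> x \in ~: S by rewrite inE => ->.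
(* Gluing needs the membership proofs themselves, hence the match on [sumbool_of_bool]. *)
pose f := [ffun x => match sumbool_of_bool (x \in S) with
   | left p => f1 (Sub x p) | right p => f2 (Sub x (notS x p)) end].
have fS x : f (val x) = f1 x.
  rewrite ffunE; case: sumbool_of_bool => p; last by have := valP x; rewrite p.
  by congr (f1 _); apply: val_inj.
have fS' x : f (val x) = f2 x.
  rewrite ffunE; case: sumbool_of_bool => p.
    by have := valP x; rewrite inE p.
  by congr (f2 _); apply: val_inj.
have cases x : (exists y : {x | x \in S}, x = val y) \/
               (exists y : {x | x \in ~: S}, x = val y).
  have [xS|xS] := boolP (x \in S); first by left; exists (Sub x xS).
  have xS' : x \in ~: S by rewrite inE.
  by right; exists (Sub x xS').
exists f; last first.
  by congr (_, _); apply/ffunP => x; rewrite ffunE ?fS ?fS'.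
rewrite inE; apply/andP; split; last first.
  by apply/colouredP => x; case: (cases x) => -[y ->]; rewrite ?fS ?fS'.
have mix x y : e x y || q x y -> x \in S -> y \in ~: S -> False.
  by move=> /clS xy xS; rewrite inE -xy xS.
have mix' x y : e x y || q x y -> x \in ~: S -> y \in S -> False.
  by move=> /clS xy; rewrite inE xy => /negP.
apply/homsP; split=> x y; case: (cases x) => -[x' ->]; case: (cases y) => -[y' ->] xy.
- by rewrite !fS fe1.
- by case: (mix (val x') (val y')); rewrite ?xy ?orbT //; apply: valP.
- by case: (mix' (val x') (val y')); rewrite ?xy ?orbT //; apply: valP.
- by rewrite !fS' fe2.
- by rewrite !fS (fq1 _ _ xy).
- by case: (mix (val x') (val y')); rewrite ?xy ?orbT //; apply: valP.
- by case: (mix' (val x') (val y')); rewrite ?xy ?orbT //; apply: valP.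
- by rewrite !fS' (fq2 _ _ xy).
Qed.

End Restriction.

(** * Counts refined by degree, and their cancellation *)

(** In use, [h] is a degree in [G_H] and [k] a degree in [G_L], so [k * h x] is a degree in the
    product. *)
Definition profile (I : finType) (h : I -> nat) (A : {set I}) (k D : nat) :=
  #|[set x in A | k * h x == D]|.

Lemma profileM (I : finType) (h : I -> nat) (A : {set I}) (k j : nat) :
  0 < k -> profile h A k (k * j) = profile h A 1 j.
Proof.
by move=> k0; apply: eq_card => x; rewrite !inE eqn_pmul2l // mul1n.
Qed.

Lemma profile_ndvd (I : finType) (h : I -> nat) (A : {set I}) (k D : nat) :
  ~~ (k %| D) -> profile h A k D = 0.
Proof.
move=> ndvd; apply: eq_card0 => x; rewrite !inE; apply/negP => /andP[_ /eqP E].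
by rewrite -E dvdn_mulr in ndvd.
Qed.

Lemma card_eq_profile (I : finType) (h : I -> nat) (A B : {set I}) :
  profile h A 1 =1 profile h B 1 -> #|A| = #|B|.
Proof.
move=> eqAB; pose M := (\max_x h x).+1.
have hM x : h x < M by rewrite ltnS leq_bigmax.
have card_sum (S : {set I}) : #|S| = \sum_(j < M) profile h S 1 j.
  rewrite -sum1_card (partition_big (fun x => Ordinal (hM x)) predT) //=.
  apply: eq_bigr => j _; rewrite sum1_card; apply: eq_card => x.
  by rewrite !inE mul1n.
by rewrite !card_sum; apply: eq_bigr.
Qed.

(* The largest level [j] at which the profiles of [A] and [B] differ would give
   a contradiction at [D = max k l * j]: the other term of the identity involves
   only the level [max k l * j / min k l], which exceeds [j]. *)
Lemma card_eq_scaled_profiles (I : finType) (h : I -> nat) (A B : {set I})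
    (k l a b : nat) :
    (forall x, 0 < h x) -> 0 < k -> 0 < l -> k <> l -> 0 < a -> 0 < b ->
    (forall D, a * profile h A k D + b * profile h B l D =
               a * profile h B k D + b * profile h A l D) ->
  #|A| = #|B|.
Proof.
(* The identity is symmetric under exchanging [(A, k, a)] with [(B, l, b)]. *)
move=> h_gt0; wlog lk : A B k l a b / l < k.
  move=> W k0 l0 kl a0 b0 E; case: (ltngtP l k) => [lk|lk|]; last by move/esym.
    exact: (W A B k l a b).
  apply/esym; apply: (W B A l k b a) => //; first by move/esym.
  by move=> D; rewrite addnC E addnC.
move=> k0 l0 _ a0 b0 E; apply: (@card_eq_profile _ h).
pose M := (\max_x h x).+1.
have hM x : h x < M by rewrite ltnS leq_bigmax.
(* Downward induction on the level [j]: from [M] on both profiles vanish. *)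
suff claim n j : M <= j + n -> profile h A 1 j = profile h B 1 j.
  by move=> j; apply: (claim M); rewrite leq_addl.
elim: n j => [|n IHn] j Mj.
  rewrite addn0 in Mj; rewrite /profile !eq_card0 // => x; rewrite !inE mul1n;
  by apply/negP => /andP[_ /eqP hx]; move: (hM x); rewrite hx ltnNge Mj.
(* Level 0 is empty since [h] is positive; it is set apart because [k * j / l] exceeds [j] only when
   [j] is positive. *)
have [->|j0] := posnP j.
  rewrite /profile !eq_card0 // => x; rewrite !inE mul1n;
  by apply/negP => /andP[_ /eqP hx]; move: (h_gt0 x); rewrite hx.
have El : profile h A l (k * j) = profile h B l (k * j).
  have [/dvdnP[j' Ej']|nd] := boolP (l %| k * j); last by rewrite !profile_ndvd.
  rewrite Ej' mulnC !profileM //; apply: IHn; suff: j < j' by lia.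
  by rewrite -(ltn_pmul2r l0) -Ej' mulnC ltn_pmul2r.
move: (E (k * j)); rewrite El !profileM // => /addIn/eqP.
by rewrite eqn_pmul2l // => /eqP.
Qed.

(** The induced map on pairs sends the finite edge set injectively into itself, hence onto it, so no
    non-edge can land on an edge. *)
Lemma injective_endo_iso (U : finType) (g : rel U) (f : U -> U) :
    injective f -> (forall x y, g x y -> g (f x) (f y)) ->
  forall x y, g (f x) (f y) = g x y.
Proof.
move=> finj fhom x y; apply/idP/idP => [gf|]; last exact: fhom.
pose E := [set z : U * U | g z.1 z.2]; pose F z := (f z.1, f z.2).
have Finj : injective F by move=> [? ?] [? ?] [/finj -> /finj ->].
have FE : F @: E = E.
  apply/eqP; rewrite eqEcard card_imset // leqnn andbT.
  by apply/subsetP => _ /imsetP[z + ->]; rewrite !inE => /fhom.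
have : (f x, f y) \in F @: E by rewrite FE inE.
by case/imsetP => -[x' y']; rewrite inE /= => gxy [/finj-> /finj->].
Qed.

(** * Homomorphisms into the two parts of the direct product *)

Section MatchingPart.
Variables (W U X : finType) (gw : rel W) (gu : rel U) (gx : rel X).
Variables (dw : W -> bool) (du : U -> bool).
Hypotheses (gwB : bipartite gw dw) (guB : bipartite gu du).

(* The parts for [b = false] and [b = true] correspond to [L (x) H] and
   [L (x) H^#]; the direct product of [gw] and [gu] is their disjoint union. *)
Definition product_part (b : bool) (pi : X -> W * U) :=
  [/\ injective pi,
      forall z, (exists x, pi x = z) <-> du z.2 = dw z.1 (+) b
    & forall x y, gx x y = gw (pi x).1 (pi y).1 && gu (pi x).2 (pi y).2].

Variables (b : bool) (pi : X -> W * U).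
Hypothesis piP : product_part b pi.

(** A sigma type rather than an existential, so that choosing preimages defines functions. *)
Lemma product_part_lift z : du z.2 = dw z.1 (+) b -> {x | pi x = z}.
Proof.
have [_ im _] := piP; move=> /im zP.
have /codomP ex : z \in codom pi by case: zP => x <-; apply: codom_f.
have ex' : exists x, pi x == z by case: zP => x <-; exists x.
by exists (xchoose ex'); apply/eqP/(xchooseP ex').
Qed.

Lemma product_part_colour x : du (pi x).2 = dw (pi x).1 (+) b.
Proof. by have [_ im _] := piP; apply/im; exists x. Qed.

(** Both colours flip along an edge of the direct product, so all pairs of neighbours stay in the
    same part. *)
Lemma degree_product_part x :
  degree gx x = degree gw (pi x).1 * degree gu (pi x).2.
Proof.
have [inj im edge] := piP; rewrite /degree -cardsX -(card_imset _ inj).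
apply: eq_card => z; rewrite !inE; apply/imsetP/andP.
  by case=> y; rewrite inE edge => /andP[? ?] ->.
move=> [e1 e2]; have [|y Ey] := @product_part_lift z; last first.
  by exists y; rewrite ?inE ?edge Ey ?e1.
have := product_part_colour x; rewrite (guB e2) (gwB e1) addNb; apply: negb_inj.
Qed.

Variables (T : finType) (e q : rel T) (c : T -> bool) (v : T) (k : bool -> nat).
Hypotheses (cP : compatible e q c) (conn : connected_from e q v).
Hypothesis gw_deg : forall w, degree gw w = k (dw w).

(** A homomorphism into the part is a pair of homomorphisms into the factors. Connectedness makes
    the first one coloured by [c] up to a shift [s]; the part then forces the shift [s (+) b] on the
    second, and degrees multiply. *)
Lemma card_homs_product_part D :
  #|[set f in homs gx e q | degree gx (f v) == D]| =
  \sum_(s : bool) #|homs gw e q :&: coloured dw (fun x => c x (+) s)| *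
    profile (fun f : {ffun T -> U} => degree gu (f v))
      (homs gu e q :&: coloured du (fun x => c x (+) (s (+) b)))
      (k (c v (+) s)) D.
Proof.
have [inj im edge] := piP.
pose F (f : {ffun T -> X}) : {ffun T -> W} * {ffun T -> U} :=
  ([ffun x => (pi (f x)).1], [ffun x => (pi (f x)).2]).
have Finj : injective F.
  move=> f1 f2 [/ffunP E1 /ffunP E2]; apply/ffunP => x; apply: inj.
  by have := E1 x; have := E2 x; rewrite !ffunE;
  case: (pi _) (pi _) => ? ? [? ?] /= -> ->.
rewrite -(card_imset _ Finj).
pose P s := setX (homs gw e q :&: coloured dw (fun x => c x (+) s))
  [set f in homs gu e q :&: coloured du (fun x => c x (+) (s (+) b)) |
    k (c v (+) s) * degree gu (f v) == D].
have PE s z : (z \in P s) = [&& z.1 \in homs gw e q,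
    z.1 \in coloured dw (fun x => c x (+) s), z.2 \in homs gu e q,
    z.2 \in coloured du (fun x => c x (+) (s (+) b))
    & k (c v (+) s) * degree gu (z.2 v) == D].
  by rewrite !inE -!andbA.
(* The shift [s] of the first component, read off at [v]. *)
pose key (z : {ffun T -> W} * {ffun T -> U}) := c v (+) dw (z.1 v).
rewrite -sum1_card (partition_big key predT) //= /key.
apply: eq_bigr => s _; rewrite sum1_card -cardsX -/(P s).
apply: eq_card => z; rewrite [LHS]unfold_in /=; apply/andP/idP => [[]|].
  case/imsetP=> f; rewrite inE => /andP[/homsP[fe fq] deg_f] Ez /eqP Es.
  have z1 x : z.1 x = (pi (f x)).1 by rewrite Ez ffunE.
  have z2 x : z.2 x = (pi (f x)).2 by rewrite Ez ffunE.
  have hom1 : z.1 \in homs gw e q.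
    apply/homsP; split=> x y xy; rewrite !z1; last by rewrite (fq _ _ xy).
    by have := fe _ _ xy; rewrite edge => /andP[].
  have col1 : z.1 \in coloured dw (fun x => c x (+) s).
    by rewrite -Es; apply: (connected_homs_coloured gwB cP conn hom1).
  rewrite PE hom1 col1 /=; apply/and3P; split.
  - apply/homsP; split=> x y xy; rewrite !z2; last by rewrite (fq _ _ xy).
    by have := fe _ _ xy; rewrite edge => /andP[].
  - apply/colouredP => x; rewrite z2 product_part_colour -z1.
    by rewrite (colouredP _ _ _ col1) addbA.
  - move/colouredP: col1 => /(_ v); rewrite z1 => <-.
    by rewrite z2 -gw_deg -degree_product_part.
rewrite PE => /and5P[/homsP[e1 q1] /colouredP c1 /homsP[e2 q2] /colouredP c2 deg].
(* The shifts [s] and [s (+) b] differ by [b], which is the condition for the pair to lie in the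
   part. *)
have lift x : {y | pi y = (z.1 x, z.2 x)}.
  by apply: product_part_lift; rewrite c1 c2 addbA.
pose f := [ffun x => sval (lift x)].
have pif x : pi (f x) = (z.1 x, z.2 x) by rewrite ffunE (svalP (lift x)).
split; last by rewrite c1 addbA addbb.
apply/imsetP; exists f.
  rewrite inE; apply/andP; split; last first.
    by rewrite degree_product_part pif gw_deg c1.
  apply/homsP; split=> x y xy; first by rewrite edge !pif /= e1 ?e2.
  by apply: inj; rewrite !pif (q1 _ _ xy) (q2 _ _ xy).
by case: z {PE c1 c2 deg e1 e2 q1 q2 lift} f pif => z1 z2 f pif;
  congr (_, _); apply/ffunP => x; rewrite ffunE pif.
Qed.
End MatchingPart.

(** * Invariance of the counts under isomorphism *)

Section Isomorphism.
Variables (X Y : finType) (gx : rel X) (gy : rel Y) (h : X -> Y).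
Hypothesis hP : is_graph_iso gx gy h.

Lemma graph_iso_inv : exists h', is_graph_iso gy gx h'.
Proof.
have [[h' hK h'K] edge] := hP; exists h'; split; first by exists h.
by move=> x y; rewrite -edge !h'K.
Qed.

Lemma degree_graph_iso x : degree gy (h x) = degree gx x.
Proof.
have [[h' hK h'K] edge] := hP; rewrite /degree -(card_imset _ (can_inj hK)).
apply: eq_card => y; rewrite inE -[y]h'K edge mem_imset ?inE //.
exact: can_inj hK.
Qed.

Lemma leq_card_homs_iso (T : finType) (e q : rel T) v D :
  #|[set f in homs gx e q | degree gx (f v) == D]| <=
  #|[set f in homs gy e q | degree gy (f v) == D]|.
Proof.
have [/bij_inj inj edge] := hP.
pose F (f : {ffun T -> X}) : {ffun T -> Y} := [ffun x => h (f x)].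
have Finj : injective F.
  by move=> f1 f2 /ffunP E; apply/ffunP => x; apply: inj; have := E x; rewrite !ffunE.
rewrite -(card_imset _ Finj); apply/subset_leq_card/subsetP => _ /imsetP[f + ->].
rewrite inE => /andP[/homsP[fe fq] deg_f]; rewrite inE ffunE degree_graph_iso deg_f.
rewrite andbT; apply/homsP; split=> x y xy; rewrite !ffunE ?edge ?fe //.
by rewrite (fq _ _ xy).
Qed.

End Isomorphism.

Lemma card_homs_iso (X Y : finType) (gx : rel X) (gy : rel Y) h
    (T : finType) (e q : rel T) v D :
    is_graph_iso gx gy h ->
  #|[set f in homs gx e q | degree gx (f v) == D]| =
  #|[set f in homs gy e q | degree gy (f v) == D]|.
Proof.
move=> hP; have [h' h'P] := graph_iso_inv hP.
by apply/eqP; rewrite eqn_leq (leq_card_homs_iso hP) (leq_card_homs_iso h'P).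
Qed.

(** The pattern folds onto a single edge, each colour class going to the endpoint of its colour. *)
Lemma homs_coloured_gt0 (T W : finType) (g : rel W) (d : W -> bool)
    (e q : rel T) (c : T -> bool) :
    symmetric g -> bipartite g d -> (exists w1 w2, g w1 w2) -> compatible e q c ->
  0 < #|homs g e q :&: coloured d c|.
Proof.
move=> gS gB [w1 [w2 g12]] [ce cq]; apply/card_gt0P.
exists [ffun x => if c x == d w1 then w1 else w2].
have d12 := gB _ _ g12; rewrite inE; apply/andP; split.
  apply/homsP; split=> x y xy; rewrite !ffunE; last by rewrite (cq _ _ xy).
  rewrite (ce _ _ xy) d12.
  by case: (c y) (d w2) => [] [] //=; rewrite ?(gS w2) g12.
by apply/colouredP => x; rewrite ffunE; case: eqP => [->|/eqP]; rewrite // d12;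
  case: (c x) (d w2) => [] [].
Qed.

(** Applying [f] to the second coordinate alone exchanges the two parts of the direct product. *)
Lemma interchanging_product_iso (W U X Y : finType) (gw : rel W) (gu : rel U)
    (gx : rel X) (gy : rel Y) (dw : W -> bool) (du : U -> bool) piX piY f :
    product_part gw gu gx dw du false piX ->
    product_part gw gu gy dw du true piY ->
    is_graph_iso gu gu f -> (forall u, du (f u) = ~~ du u) ->
  graph_isomorphic gx gy.
Proof.
move=> XP YP [[f' fK f'K] fE] fd.
have fd' u : du (f' u) = ~~ du u by rewrite -[in RHS](f'K u) fd negbK.
have liftY x : {y | piY y = ((piX x).1, f (piX x).2)}.
  by apply: (product_part_lift YP); rewrite fd (product_part_colour XP) addbT addbF.
have liftX y : {x | piX x = ((piY y).1, f' (piY y).2)}.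
  apply: (product_part_lift XP); rewrite fd' (product_part_colour YP).
  by rewrite addbT addbF negbK.
have [Xinj _ Xedge] := XP; have [Yinj _ Yedge] := YP.
exists (fun x => sval (liftY x)); split.
  exists (fun y => sval (liftX y)) => z.
    apply: Xinj; rewrite (svalP (liftX _)) (svalP (liftY _)) /= fK.
    by rewrite -surjective_pairing.
  apply: Yinj; rewrite (svalP (liftY _)) (svalP (liftX _)) /= f'K.
  by rewrite -surjective_pairing.
by move=> x y; rewrite Yedge !(svalP (liftY _)) /= fE Xedge.
Qed.

(** * From an isomorphism of the parts to a colour-reversing automorphism *)

Section Cancellation.
Variables (W U X Y : finType) (gw : rel W) (gu : rel U) (gx : rel X) (gy : rel Y).
Variables (dw : W -> bool) (du : U -> bool) (k : bool -> nat).
Variables (piX : X -> W * U) (piY : Y -> W * U) (h : X -> Y).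
Hypotheses (gwS : symmetric gw) (gwB : bipartite gw dw) (guB : bipartite gu du).
Hypotheses (gw_edge : exists w1 w2, gw w1 w2) (gu_noiso : no_isolated_vertex gu).
Hypotheses (gw_deg : forall w, degree gw w = k (dw w)).
Hypotheses (k_gt0 : forall s, 0 < k s) (k_neq : k true <> k false).
Hypothesis XP : product_part gw gu gx dw du false piX.
Hypothesis YP : product_part gw gu gy dw du true piY.
Hypothesis hP : is_graph_iso gx gy h.

Lemma compatible_addb (T : finType) (e q : rel T) c s :
  compatible e q c -> compatible e q (fun x => c x (+) s).
Proof.
by move=> [ce cq]; split=> x y xy; rewrite ?(ce _ _ xy) ?(cq _ _ xy) ?addNb.
Qed.

Lemma connected_card_homs_flip (T : finType) (e q : rel T) c v :
    compatible e q c -> connected_from e q v ->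
  #|homs gu e q :&: coloured du (fun x => c x (+) true)| =
  #|homs gu e q :&: coloured du (fun x => c x (+) false)|.
Proof.
move=> cP conn.
pose a s := #|homs gw e q :&: coloured dw (fun x => c x (+) s)|.
apply: (@card_eq_scaled_profiles _ (fun f : {ffun T -> U} => degree gu (f v))
  _ _ (k (c v (+) true)) (k (c v (+) false)) (a true) (a false)) => //.
- move=> f; apply/card_gt0P; have [u] := gu_noiso (f v).
  by exists u; rewrite inE.
- by case: (c v) => //=; move/esym.
- exact/homs_coloured_gt0/compatible_addb.
- exact/homs_coloured_gt0/compatible_addb.
(* The shifts on the two factors agree in the part [false] and differ in the part [true]; equating
   the counts is the scaled profile identity. *)
move=> D; have := card_homs_iso e q v D hP.
rewrite (card_homs_product_part gwB guB XP cP conn gw_deg).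
rewrite (card_homs_product_part gwB guB YP cP conn gw_deg).
by rewrite !big_bool.
Qed.

(** Strong induction on the size of [T]: a proper nonempty closed set factors both counts, and
    otherwise [T] is empty or connected. *)
Lemma card_homs_flip (T : finType) (e q : rel T) c :
  #|homs gu e q :&: coloured du (fun x => c x (+) true)| =
  #|homs gu e q :&: coloured du c|.
Proof.
have [n] := ubnP #|T|; elim: n T e q c => // n IHn T e q c Tn.
have [S /and3P[/'forall_forallP clS S0 ST]|no_split] := pickP (fun S : {set T} =>
  [&& [forall x, forall y, (e x y || q x y) ==> ((x \in S) == (y \in S))],
      S != set0 & S != setT]).
  have {}clS : closed_under e q S.
    by move=> x y xy; apply/eqP; apply: implyP xy; apply: clS.
  have card_lt (A : {set T}) : A != setT -> #|{: {x | x \in A}}| < n.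
    rewrite -properT => /proper_card; rewrite card_sig cardsT => AT.
    by apply: leq_trans AT _.
  rewrite !(card_homs_split _ _ _ clS) /sub_homs !IHn ?card_lt //.
  by rewrite -setC0 (inj_eq (@setC_inj _)).
have [v _|T0] := pickP (@predT T); last first.
  congr #|pred_of_set (_ :&: _)|; apply/setP => f.
  by apply/colouredP/colouredP => _ x; have := T0 x.
have conn : connected_from e q v.
  move=> S clS vS; apply/eqP; move/negbT: (no_split S); rewrite !negb_and !negbK.
  case/or3P => // [/negP[]|/eqP S0]; last by rewrite S0 inE in vS.
  by apply/'forall_forallP => x y; apply/implyP => /clS ->.
have colF : coloured du (fun x => c x (+) false) = coloured du c :> {set {ffun T -> U}}.
  by apply/setP => f; apply/colouredP/colouredP => H x; rewrite H addbF.
(* A homomorphism of either colouring forces [c] to be compatible; if [c] is not, both sets are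
   empty. *)
rewrite -colF; have compat_of s f :
    f \in homs gu e q :&: coloured du (fun x => c x (+) s) -> compatible e q c.
  rewrite in_setI => /andP[fh /(homs_compatible guB fh)/(compatible_addb s)[ce cq]].
  by split=> x y xy; [have := ce _ _ xy | have := cq _ _ xy]; rewrite !addbK.
case: (set_0Vmem (homs gu e q :&: coloured du (fun x => c x (+) true))) => [E1|[f]];
  last by move/compat_of => cP; apply: connected_card_homs_flip conn.
case: (set_0Vmem (homs gu e q :&: coloured du (fun x => c x (+) false))) => [E2|[f]];
  last by move/compat_of => cP; apply: connected_card_homs_flip conn.
by rewrite E1 E2.
Qed.

(** A list of pairs, so that injectivity can be imposed one pair at a time. *)
Definition separating (T : finType) (R : seq (T * T)) : {set {ffun T -> U}} :=
  [set f : {ffun T -> U} | all (fun r => f r.1 != f r.2) R].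

(* The maps with [f r.1 = f r.2] are counted by adding [r] to the equality
   constraints [q], which plays the role of passing to a quotient of [T]. *)
Lemma card_separating_homs_flip (T : finType) (e q : rel T) c (R : seq (T * T)) :
  #|homs gu e q :&: coloured du (fun x => c x (+) true) :&: separating R| =
  #|homs gu e q :&: coloured du c :&: separating R|.
Proof.
elim: R q => [|r R IHR] q.
  have -> : separating [::] = setT :> {set {ffun T -> U}}.
    by apply/setP => f; rewrite !inE.
  by rewrite !setIT card_homs_flip.
pose q' x y := q x y || ((x, y) == r).
have split_card c' :
    #|homs gu e q :&: coloured du c' :&: separating R| =
    #|homs gu e q' :&: coloured du c' :&: separating R| +
    #|homs gu e q :&: coloured du c' :&: separating (r :: R)|.
  rewrite -(cardsID [set f : {ffun T -> U} | f r.1 == f r.2]).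
  congr (_ + _); apply: eq_card => f.
    rewrite 5!in_setI andbAC; congr (_ && _); rewrite andbAC; congr (_ && _).
    rewrite [X in _ && X]in_set; apply/andP/homsP.
      case=> /homsP[fe fq] /eqP fr; split=> // x y /orP[/fq //|/eqP E].
      by rewrite -E in fr.
    move=> [fe fq]; split; last first.
      by apply/eqP/fq; rewrite /q' -surjective_pairing eqxx orbT.
    by apply/homsP; split=> // x y xy; apply: fq; rewrite /q' xy.
  rewrite in_setD 4!in_setI andbC -!andbA; congr [&& _, _ & _].
  by rewrite !in_set /= andbC.
apply/eqP; rewrite -(eqn_add2l #|homs gu e q' :&: coloured du c :&: separating R|).
(* The induction hypothesis is used for both [q'] and [q]; subtraction leaves the separated maps. *)
by rewrite -split_card -{1}IHR -split_card IHR.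
Qed.

Lemma exists_interchanging :
  exists f, is_graph_iso gu gu f /\ forall u, du (f u) = ~~ du u.
Proof.
pose R := [seq r : U * U <- enum {: U * U} | r.1 != r.2].
have sepP (f : {ffun U -> U}) : reflect (injective f) (f \in separating R).
  rewrite inE; apply: (iffP allP) => [H x y Exy|inj r].
    apply/eqP/negP => /negP nxy; have := H (x, y).
    by rewrite mem_filter nxy mem_enum Exy eqxx => /(_ isT).
  by rewrite mem_filter (inj_eq inj) => /andP[].
(* The pattern is [gu] itself, coloured by [du]. After flipping the colours the count includes the
   identity map, so it is positive. *)
have : 0 < #|homs gu gu (fun _ _ => false) :&:
              coloured du (fun x => du x (+) true) :&: separating R|.
  rewrite card_separating_homs_flip; apply/card_gt0P; exists [ffun x => x].
  rewrite 2!in_setI -andbA; apply/and3P; split.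
  - by apply/homsP; split=> x y; rewrite ?ffunE.
  - by apply/colouredP => x; rewrite ffunE.
  - by apply/sepP => x y; rewrite !ffunE.
case/card_gt0P=> f; rewrite 2!in_setI.
move=> /andP[/andP[/homsP[fe _] /colouredP fc] /sepP inj].
exists f; split; last by move=> u; rewrite fc addbT.
by split; [apply: injF_bij | apply: injective_endo_iso].
Qed.

End Cancellation.

(** * The 2-colouring of a bipartite graph given by a matrix *)

Definition row_side (a b : nat) (x : 'I_(a + b)) : bool := x < a.

Lemma row_side_lshift a b (i : 'I_a) : row_side (lshift b i).
Proof. exact: (ltn_ord i). Qed.

Lemma row_side_rshift a b (j : 'I_b) : row_side (rshift a j) = false.
Proof. by rewrite /row_side /= ltnNge leq_addr. Qed.

Definition row_sideE := (row_side_lshift, row_side_rshift).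

Lemma mem_row_part a b x : (x \in row_part a b) = row_side x.
Proof.
case: (split_ordP x) => i ->; rewrite row_sideE; first exact: imset_f.
by apply/imsetP => -[j _ /eqP]; rewrite eq_rlshift.
Qed.

Lemma mem_col_part a b x : (x \in col_part a b) = ~~ row_side x.
Proof.
case: (split_ordP x) => i ->; rewrite row_sideE; last exact: imset_f.
by apply/imsetP => -[j _ /eqP]; rewrite eq_lrshift.
Qed.

Section BipMx.
Local Open Scope ring_scope.
Variables (a b : nat) (A : 'M[int]_(a, b)).
Local Notation g := (mxgraph (bip_mx A)).

Lemma bip_mxgraphE :
  (forall i j, g (lshift b i) (rshift a j) = (A i j == 1)) *
  (forall i j, g (rshift a j) (lshift b i) = (A i j == 1)) *
  (forall i j, g (lshift b i) (lshift b j) = false) *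
  (forall i j, g (rshift a i) (rshift a j) = false).
Proof.
split; first split; first split; move=> i j; rewrite /mxgraph /bip_mx.
- by rewrite block_mxEur.
- by rewrite block_mxEdl mxE.
- by rewrite block_mxEul mxE.
- by rewrite block_mxEdr mxE.
Qed.

Lemma bip_mxgraph_bipartite : bipartite g (@row_side a b).
Proof.
by move=> x y; case: (split_ordP x) => i ->; case: (split_ordP y) => j ->;
  rewrite !row_sideE // bip_mxgraphE.
Qed.

End BipMx.

(** The restriction to 0 and 1 excludes [(-1) * (-1) = 1]; it makes an entry of the tensor product
    an edge exactly when both factors are edges. *)
Lemma mulz01_eq1 (x y : int) : (x = 0 \/ x = 1 -> y = 0 \/ y = 1 ->
  (x * y == 1) = (x == 1) && (y == 1))%R.
Proof. by case=> ->; case=> ->. Qed.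

(** * The partitioned tensor products as the two parts of the direct product *)

Section TensorParts.
Variables (m n p q : nat) (V : 'M[int]_(m, n)) (B : 'M[int]_(p, q)).
Hypotheses (V01 : is_01mx V) (B01 : is_01mx B).

Definition tens_coord (x : 'I_(m * p + n * q)) : 'I_(m + n) * 'I_(p + q) :=
  match split x with
  | inl i => (lshift n (mxtens_unindex i).1, lshift q (mxtens_unindex i).2)
  | inr j => (rshift m (mxtens_unindex j).1, rshift p (mxtens_unindex j).2)
  end.

(** Transposing [B] pairs rows of [V] with columns of [B] and conversely, so the two colours always
    differ. *)
Definition tens_sharp_coord (x : 'I_(m * q + n * p)) : 'I_(m + n) * 'I_(p + q) :=
  match split x with
  | inl i => (lshift n (mxtens_unindex i).1, rshift p (mxtens_unindex i).2)
  | inr j => (rshift m (mxtens_unindex j).1, lshift q (mxtens_unindex j).2)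
  end.

Lemma tens_coordE :
  (forall i r, tens_coord (lshift _ (mxtens_index (i, r))) = (lshift n i, lshift q r)) *
  (forall j s, tens_coord (rshift _ (mxtens_index (j, s))) = (rshift m j, rshift p s)).
Proof.
by split=> i r; rewrite /tens_coord ?(unsplitK (inl _)) ?(unsplitK (inr _)) mxtens_indexK.
Qed.

Lemma tens_sharp_coordE :
  (forall i r, tens_sharp_coord (lshift _ (mxtens_index (i, r))) =
    (lshift n i, rshift p r)) *
  (forall j s, tens_sharp_coord (rshift _ (mxtens_index (j, s))) =
    (rshift m j, lshift q s)).
Proof.
by split=> i r; rewrite /tens_sharp_coord ?(unsplitK (inl _)) ?(unsplitK (inr _))
  mxtens_indexK.
Qed.

Lemma product_part_tens :
  product_part (mxgraph (bip_mx V)) (mxgraph (bip_mx B))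
    (mxgraph (part_tensmx (bip_mx V) (bip_mx B)))
    (@row_side m n) (@row_side p q) false tens_coord.
Proof.
split.
- move=> x y; case: (split_ordP x) => x' ->; case: (split_ordP y) => y' ->;
  case: (mxtens_indexP x') => x1 x2; case: (mxtens_indexP y') => y1 y2;
  rewrite !tens_coordE => /eqP; rewrite xpair_eqE ?eq_lshift
    ?eq_rshift ?eq_lrshift ?eq_rlshift ?andbF // => /andP[/eqP-> /eqP->] //.
- case=> w u; split=> [[x <-]|].
    by case: (split_ordP x) => x' ->; case: (mxtens_indexP x') => x1 x2;
      rewrite tens_coordE !row_sideE.
  case: (split_ordP w) => i ->; case: (split_ordP u) => r ->;
    rewrite !row_sideE // => _.
  + by exists (lshift _ (mxtens_index (i, r))); rewrite tens_coordE.
  + by exists (rshift _ (mxtens_index (i, r))); rewrite tens_coordE.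
- rewrite part_tensmx_bip => x y; case: (split_ordP x) => x' ->;
  case: (split_ordP y) => y' ->;
  case: (mxtens_indexP x') => x1 x2; case: (mxtens_indexP y') => y1 y2;
  rewrite !tens_coordE !bip_mxgraphE ?tensmxE ?mxE ?mulz01_eq1 //.
Qed.

Lemma product_part_tens_sharp :
  product_part (mxgraph (bip_mx V)) (mxgraph (bip_mx B))
    (mxgraph (part_tensmx (bip_mx V) (bip_mx_sharp B)))
    (@row_side m n) (@row_side p q) true tens_sharp_coord.
Proof.
split.
- move=> x y; case: (split_ordP x) => x' ->; case: (split_ordP y) => y' ->;
  case: (mxtens_indexP x') => x1 x2; case: (mxtens_indexP y') => y1 y2;
  rewrite !tens_sharp_coordE => /eqP; rewrite xpair_eqE ?eq_lshift
    ?eq_rshift ?eq_lrshift ?eq_rlshift ?andbF // => /andP[/eqP-> /eqP->] //.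
- case=> w u; split=> [[x <-]|].
    by case: (split_ordP x) => x' ->; case: (mxtens_indexP x') => x1 x2;
      rewrite tens_sharp_coordE !row_sideE.
  case: (split_ordP w) => i ->; case: (split_ordP u) => r ->;
    rewrite !row_sideE // => _.
  + by exists (lshift _ (mxtens_index (i, r))); rewrite tens_sharp_coordE.
  + by exists (rshift _ (mxtens_index (i, r))); rewrite tens_sharp_coordE.
- rewrite part_tensmx_bip_sharp => x y; case: (split_ordP x) => x' ->;
  case: (split_ordP y) => y' ->;
  case: (mxtens_indexP x') => x1 x2; case: (mxtens_indexP y') => y1 y2;
  rewrite !tens_sharp_coordE !bip_mxgraphE ?tensmxE ?mxE ?mulz01_eq1 //.
Qed.

End TensorParts.

(** * The equivalence for the matrices [V] and [B] *)

Local Open Scope ring_scope.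

Theorem theorem4p6 (m n p q : nat)
    (V : 'M[int]_(m, n)) (B : 'M[int]_(p, q))
    (m_gt0 : (0 < m)%N) (n_gt0 : (0 < n)%N)
    (V01 : is_01mx V) (B01 : is_01mx B)
    (L_noiso : no_isolated_vertex (mxgraph (bip_mx V)))
    (H_noiso : no_isolated_vertex (mxgraph (bip_mx B)))
    (L_bireg : biregular_distinct (mxgraph (bip_mx V))
                 (row_part m n) (col_part m n))
    (H_balanced : p = q) :
  ~ graph_isomorphic (mxgraph (part_tensmx (bip_mx V) (bip_mx B)))
                     (mxgraph (part_tensmx (bip_mx V) (bip_mx_sharp B)))
  <->
  ~ exists f : 'I_(p + q) -> 'I_(p + q),
      interchanging_automorphism (mxgraph (bip_mx B))
        (row_part p q) (col_part p q) f.
Proof.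
suff iso_iff : graph_isomorphic (mxgraph (part_tensmx (bip_mx V) (bip_mx B)))
                 (mxgraph (part_tensmx (bip_mx V) (bip_mx_sharp B))) <->
    exists f : 'I_(p + q) -> 'I_(p + q),
      interchanging_automorphism (mxgraph (bip_mx B))
        (row_part p q) (col_part p q) f by rewrite iso_iff.
have XP := product_part_tens V01 B01; have YP := product_part_tens_sharp V01 B01.
have VB := @bip_mxgraph_bipartite _ _ V; have BB := @bip_mxgraph_bipartite _ _ B.
split=> [[h hP] | [f [fP frow fcol]]]; last first.
  apply: (interchanging_product_iso XP YP fP) => u.
  have [uR|uC] := boolP (row_side u).
    by apply: negbTE; rewrite -mem_col_part -frow imset_f ?mem_row_part.
  by rewrite -mem_row_part -fcol imset_f ?mem_col_part.
have [k [l [Vrow Vcol kl]]] := L_bireg.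
pose kk (s : bool) := if s then k else l.
have V_deg w : degree (mxgraph (bip_mx V)) w = kk (row_side w).
  have [wR|wC] := boolP (row_side w); first by rewrite Vrow ?mem_row_part.
  by rewrite Vcol ?mem_col_part.
have deg_gt0 w : (0 < degree (mxgraph (bip_mx V)) w)%N.
  by have [w' ww'] := L_noiso w; apply/card_gt0P; exists w'; rewrite inE.
(* Each side of [G_L] has a vertex, and it is not isolated, so both degrees are positive. *)
have kk_gt0 s : (0 < kk s)%N.
  case: s; first by rewrite -(row_side_lshift n (Ordinal m_gt0)) -V_deg.
  by rewrite -(row_side_rshift m (Ordinal n_gt0)) -V_deg.
have V_edge : exists w1 w2, mxgraph (bip_mx V) w1 w2.
  by exists (lshift n (Ordinal m_gt0)); apply: L_noiso.
have [f [fP fd]] := exists_interchanging (@bip_mxgraph_sym _ _ V) VB BB V_edge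
  H_noiso V_deg kk_gt0 kl XP YP hP.
have [[f' fK f'K] _] := fP.
(* The inverse also flips sides, which gives the reverse inclusions between the images and the
   parts. *)
have fd' u : row_side (f' u) = ~~ row_side u by rewrite -[in RHS](f'K u) fd negbK.
exists f; split=> //; apply/setP => u; apply/imsetP/idP => [[x xS ->]|uS].
- by move: xS; rewrite mem_row_part mem_col_part fd negbK.
- by exists (f' u); rewrite ?f'K // mem_row_part fd' -mem_col_part.
- by move: xS; rewrite mem_row_part mem_col_part fd.
- by exists (f' u); rewrite ?f'K // mem_col_part fd' negbK -mem_row_part.
Qed.
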